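(* Let $P$ be a finite poset, $\mathbb{K}$ a field of characteristic zero, $C\in\mathbb{K}$ a generic constant, and $v\in P$. Let $(x_1,\dots,x_k)$ be a linear extension of the subposet $\{x\in P: x<v\}$, put $\eta_v=T_{x_1}T_{x_2}\cdots T_{x_k}$ and $\tau_v^*=\eta_vT_v\eta_v^{-1}$. Then $\Theta\circ\Delta^{-1}\circ\tau_v=\tau_v^*\circ\Theta\circ\Delta^{-1}$ on the domains where these maps are defined.
   Context: $\mathbb{K}^P$ is the set of labelings $f:P\to\mathbb{K}$; all maps are birational maps $\mathbb{K}^P\dashrightarrow\mathbb{K}^P$ and products denote composition, rightmost first. A linear extension of a poset $Q$ is a listing of its elements such that $x_i<x_j$ implies $i<j$. $\widehat P$ is $P$ with a new minimum $\widehat0$ and maximum $\widehat1$; $x\lessdot y$ means $y$ covers $x$ in $\widehat P$. Birational order toggle: $T_v$ changes only the label at $v$: $(T_vf)(v)=\dfrac{\sum_{y\in\widehat P,\,y\lessdot v}f(y)}{f(v)\sum_{y\in\widehat P,\,y\gtrdot v}1/f(y)}$, with $f(\widehat0)=1$, $f(\widehat1)=C$; each $T_v$ is an involution. Birational antichain toggle: $\tau_v$ changes only the label at $v$: $(\tau_vg)(v)=C/\sum g(y_1)\cdots g(y_k)$, the sum over all maximal chains $(y_1,\dots,y_k)$ of $P$ containing $v$. $(\Theta f)(x)=C/f(x)$; $(\Delta^{-1}f)(x)=\sum f(y_1)\cdots f(y_k)$ over all chains $x=y_1\lessdot y_2\lessdot\cdots\lessdot y_k\lessdot\widehat1$ in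 $\widehat P$. *)

(* Defs.v *)
From HB Require Import structures.
From mathcomp Require Import all_boot all_order all_algebra.
From mathcomp Require Import mpoly ring.

Set Implicit Arguments.
Unset Strict Implicit.
Unset Printing Implicit Defensive.

Import Order.TTheory GRing.Theory.
Local Open Scope ring_scope.

Notation "F '\po' G" := (pcomp F G) (at level 50, left associativity).

(* [inl false] and [inl true] are the adjoined minimum and maximum. *)
Notation hat P := (bool + P)%type.

Section Poset.
Context {d : Order.disp_t} {P : finPOrderType d}.
Implicit Types (x y : P) (s : seq P) (A : {set P}).

Definition hat0 : hat P := inl false.
Definition hat1 : hat P := inl true.
Definition elt x : hat P := inr x.

Definition hat_lt (a b : hat P) : bool :=
  match a, b with
  | inl false, inl false => false
  | inl false, _ => true
  | inl true, _ => false
  | inr _, inl b => b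
  | inr x, inr y => (x < y)%O
  end.

Definition covers (a b : hat P) : bool :=
  hat_lt a b && ~~ [exists c, hat_lt a c && hat_lt c b].

Definition chain A : bool :=
  [forall x in A, forall y in A, (x >=< y)%O].

Definition linear_extension (Q : pred P) s : Prop :=
  [/\ uniq s, s =i Q &
      {in s &, forall x y, (x < y)%O -> (index x s < index y s)%N}].

End Poset.

Section Maps.
Context {K : fieldType} {d : Order.disp_t} {P : finPOrderType d}.

(* A rational map is encoded as a partial function: its value is [None] exactly
   where one of the denominators of its defining formula vanishes, and [pcomp]
   composes such maps, rightmost first. *)
Definition labeling : Type := {ffun P -> K}.
Definition ratmap : Type := labeling -> option labeling.

Implicit Types (C : K) (f g : labeling) (v x : P) (s : seq P).

Definition hat_label C f (a : hat P) : K :=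
  match a with
  | inl false => 1
  | inl true => C
  | inr x => f x
  end.

Definition relabel v (c : K) f : labeling :=
  [ffun x => if x == v then c else f x].

Definition order_toggle C v : ratmap := fun f =>
  let lower := \sum_(a : hat P | covers a (elt v)) hat_label C f a in
  let upper := \sum_(a : hat P | covers (elt v) a) (hat_label C f a)^-1 in
  if [&& f v != 0,
         [forall (a : hat P | covers (elt v) a), hat_label C f a != 0]
       & upper != 0]
  then Some (relabel v (lower / (f v * upper)) f)
  else None.

Definition antichain_toggle C v : ratmap := fun g =>
  let total := \sum_(A : {set P} | maxset chain A && (v \in A))
                 \prod_(y in A) g y in
  if total != 0 then Some (relabel v (C / total) g) else None.

Definition Theta C : ratmap := fun f =>
  if [forall x, f x != 0] then Some [ffun x => C / f x] else None.

(* The bound #|P| on the length loses no chain: a chain has no repetition. *)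
Definition Delta_inv : ratmap := fun f =>
  Some [ffun x => \sum_(s : #|P|.-bseq P |
                        (ohead s == Some x)
                        && sorted covers (rcons (map elt s) hat1))
                    \prod_(y <- s) f y].

(* [toggles C [:: x_1; ...; x_k]] is T_{x_1} T_{x_2} ... T_{x_k}. *)
Definition toggles C s : ratmap :=
  foldr (fun x F => order_toggle C x \po F) Some s.

(* As each toggle is an involution, the inverse of [toggles C s] is
   [toggles C (rev s)]; see [order_toggleK] and [toggles_revK]. *)
Definition tau_star C s v : ratmap :=
  toggles C s \po order_toggle C v \po toggles C (rev s).

(* "For generic f" and "for generic C": outside the zero locus of some nonzero
   polynomial.  Over an infinite field, this is a dense Zariski-open set. *)
Definition generic_labeling (D : labeling -> Prop) : Prop :=
  exists2 p : {mpoly K[#|P|]}, p != 0 &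
    forall f, p.@[fun i => f (enum_val i)] != 0 -> D f.

Definition generic_constant (D : K -> Prop) : Prop :=
  exists2 q : {poly K}, q != 0 & forall C, q.[C] != 0 -> D C.

Lemma order_toggleK C v f g h :
  order_toggle C v f = Some g -> order_toggle C v g = Some h -> h = f.
Proof.
rewrite /order_toggle.
set lf := \sum_(a | _) hat_label C f a; set uf := \sum_(a | _) (hat_label C f a)^-1.
case: ifP => // /and3P[fv0 _ uf0] [<-].
set g' := relabel _ _ _.
have gE (a : hat P) : a != elt v -> hat_label C g' a = hat_label C f a.
  by case: a => [[]|x] //= ne; rewrite ffunE ifN.
have irr (a : hat P) : ~~ covers a a.
  by rewrite /covers; case: a => [[]|x] //=; rewrite ltxx.
have -> : \sum_(a | covers a (elt v)) hat_label C g' a = lf.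
  by apply: eq_bigr => a ca; rewrite gE //; apply: contraTneq ca => ->; apply: irr.
have -> : \sum_(a | covers (elt v) a) (hat_label C g' a)^-1 = uf.
  by apply: eq_bigr => a ca; rewrite gE //; apply: contraTneq ca => ->; apply: irr.
case: ifP => // /and3P[]; rewrite ffunE eqxx => g0 _ _ [<-].
have lf0 : lf != 0 by apply: contraNneq g0 => ->; rewrite mul0r.
apply/ffunP => x; rewrite !ffunE; case: eqP => // ->.
by rewrite invfM invfM invrK; field; rewrite ?lf0 ?uf0 ?fv0.
Qed.

Lemma toggles_revK C s f g h :
  toggles C (rev s) f = Some g -> toggles C s g = Some h -> h = f.
Proof.
elim: s f g h => [|x s IHs] f g h; first by case=> <- [].
have tcat t t' u : toggles C (t ++ t') u = pcomp (toggles C t) (toggles C t') u.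
  elim: t => [|y t IHt] /=; first by rewrite /pcomp; case: (toggles _ _ _).
  by rewrite {1}/pcomp IHt /pcomp; case: (toggles C t' u).
rewrite rev_cons -cats1 tcat /pcomp /= /pcomp /=.
case Ef: (order_toggle C x f) => [f1|] //= Eg.
case Eh: (toggles C s g) => [h1|] //= Eh1.
by rewrite (IHs _ _ _ Eg Eh) in Eh1; apply: order_toggleK Ef Eh1.
Qed.

End Maps.

(* Main.v *)
Require Import Defs.
From mathcomp Require Import all_boot all_order all_algebra.
From mathcomp Require Import mpoly ring.

Import Order.TTheory GRing.Theory.
Local Open Scope ring_scope.

(* For a labeling f and Q a subset of P, let S_Q be the sum over the maximal chains of Q
   of the products of their labels, and abbreviate S_{<x}, S_{>x} for the sets of
   elements below and above x.  Splitting a chain at its extremal element gives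
   recursions along covers, so (Delta^-1 f)(x) = f(x) S_{>x}, and the sum defining
   tau_v has the value f(v) S_{<v} S_{>v}.  Toggling the elements below v, then v, from
   the bottom up replaces the labels C / (f(x) S_{>x}) by f(x) S_{<x}.  Let f' be
   the image of f under tau_v.  The label f(v) S_{<v} equals C / (f'(v) S'_{>v}), and
   toggling back from the top down replaces f(x) S_{<x} by C / (f'(x) S'_{>x}).
   Every step is explicit, so the domains are described by the nonvanishing of
   finitely many of these sums; each is affine in the label of v, hence polynomial
   after clearing the denominator of tau_v, and they are nonzero at the labeling by
   ones for all but finitely many C. *)

(** * Maximal chains of a subset *)

Section ChainSum.
Context {d : Order.disp_t} {P : finPOrderType d}.
Implicit Types (x y z v : P) (A B Q : {set P}).

Definition maxchain_in Q : pred {set P} :=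
  maxset (fun A => chain A && (A \subset Q)).

Definition comp_set v : {set P} := [set x | (x != v) && (x >=< v)%O].
Definition lt_set v : {set P} := [set x | (x < v)%O].
Definition gt_set v : {set P} := [set x | (v < x)%O].

Lemma chainP A : reflect {in A &, forall x y, (x >=< y)%O} (chain A).
Proof.
apply: (iffP forall_inP) => [H x y Ax Ay|H x Ax].
  by have /forall_inP := H x Ax; apply.
by apply/forall_inP => y Ay; apply: H.
Qed.

Lemma maxchain_inP Q A :
  reflect [/\ {in A &, forall x y, (x >=< y)%O}, {subset A <= Q} &
              forall y, y \in Q -> {in A, forall x, (x >=< y)%O} -> y \in A]
          (maxchain_in Q A).
Proof.
apply: (iffP maxsetP) => [[/andP[/chainP cA /subsetP sA] maxA]|[cA sA maxA]].
  split=> // y Qy cy; rewrite -(maxA (y |: A)) ?setU11 ?subsetUr //.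
  apply/andP; split; last first.
    by apply/subsetP => x /setU1P[->|/sA].
  apply/chainP => x z /setU1P[->|Ax] /setU1P[->|Az]; rewrite ?comparablexx //.
  - by rewrite comparable_sym cy.
  - exact: cy.
  - exact: cA.
split; first by apply/andP; split; [apply/chainP|apply/subsetP].
move=> B /andP[/chainP cB /subsetP sB] /subsetP AB; apply/setP => y.
apply/idP/idP => [By|/AB //]; apply: maxA (sB _ By) _ => x /AB Bx.
exact: cB.
Qed.

Lemma maxchain_inT A : maxchain_in setT A = maxset chain A.
Proof.
by apply/maxsetP/maxsetP => -[cA maxA]; split=> [|B]; rewrite ?subsetT ?andbT // in cA *;
  move=> cB AB; apply: maxA; rewrite ?cB ?subsetT.
Qed.

(** A chain through [v] consists of [v] and elements comparable to it, so deleting [v] preserves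
    maximality. The round-trip clause is the condition that [reindex_onto] produces. *)
Lemma maxchain_in_comp Q v B : v \in Q ->
  [&& maxchain_in Q (v |: B), v \in v |: B & (v |: B) :\ v == B] =
  maxchain_in (Q :&: comp_set v) B.
Proof.
move=> Qv; rewrite setU11 /=; apply/andP/idP.
  move=> [/maxchain_inP[cA sA maxA] /eqP BE].
  have vB : v \notin B by rewrite -BE !inE eqxx.
  apply/maxchain_inP; split=> [x y Bx By|x Bx|y].
  - by apply: cA; rewrite !inE ?Bx ?By orbT.
  - rewrite !inE sA ?(cA x v) ?inE ?eqxx ?Bx ?orbT //= andbT.
    by apply: contraNneq vB => <-.
  rewrite !inE => /and3P[Qy yv cyv] cB.
  have /setU1P[yE|//] : y \in v |: B.
    apply: maxA => // x /setU1P[->|/cB //]; by rewrite comparable_sym.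
  by rewrite yE eqxx in yv.
move=> /maxchain_inP[cB sB maxB].
have vB : v \notin B by apply/negP => /sB; rewrite !inE eqxx andbF.
split; last by rewrite setU1K.
have cv x : x \in B -> (x >=< v)%O by move/sB; rewrite !inE => /and3P[].
apply/maxchain_inP; split=> [x y||y Qy cy].
- move=> /setU1P[->|Bx] /setU1P[->|By]; rewrite ?comparablexx ?cv //.
    by rewrite comparable_sym cv.
  exact: cB.
- by move=> x /setU1P[->//|/sB /setIP[]].
rewrite !inE; case: eqVneq => //= yv.
apply: maxB => [|x Bx]; last by apply: cy; rewrite !inE Bx orbT.
by rewrite !inE Qy yv comparable_sym cy // setU11.
Qed.

(** Cross comparability lets the chains in the two parts be chosen independently. The equation
    between pairs is again the [reindex_onto] condition. *)
Lemma maxchain_inU Q1 Q2 A1 A2 :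
  [disjoint Q1 & Q2] -> {in Q1 & Q2, forall x y, (x >=< y)%O} ->
  maxchain_in (Q1 :|: Q2) (A1 :|: A2) &&
    (((A1 :|: A2) :&: Q1, (A1 :|: A2) :&: Q2) == (A1, A2)) =
  maxchain_in Q1 A1 && maxchain_in Q2 A2.
Proof.
move=> /pred0P dQ cQ.
have dis x : x \in Q1 -> x \in Q2 -> False.
  by move=> q1 q2; have := dQ x; rewrite /= q1 q2.
apply/andP/andP.
  move=> [/maxchain_inP[cA sA maxA] /eqP[E1 E2]].
  have s1 : {subset A1 <= Q1} by move=> x; rewrite -E1 => /setIP[].
  have s2 : {subset A2 <= Q2} by move=> x; rewrite -E2 => /setIP[].
  split; apply/maxchain_inP; split=> //.
  - by move=> x y Ax Ay; apply: cA; rewrite inE ?Ax ?Ay.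
  - move=> y Qy cy; rewrite -E1 inE Qy andbT; apply: maxA; first by rewrite inE Qy.
    by move=> x /setUP[/cy //|/s2 Q2x]; rewrite comparable_sym; apply: cQ.
  - by move=> x y Ax Ay; apply: cA; rewrite inE ?Ax ?Ay orbT.
  - move=> y Qy cy; rewrite -E2 inE Qy andbT; apply: maxA; first by rewrite inE Qy orbT.
    by move=> x /setUP[/s1 Q1x|/cy //]; apply: cQ.
move=> [/maxchain_inP[c1 s1 max1] /maxchain_inP[c2 s2 max2]]; split.
  apply/maxchain_inP; split=> [x y|x|y].
  - move=> /setUP[Ax|Ax] /setUP[Ay|Ay]; [exact: c1| | |exact: c2].
      by apply: cQ; [apply: s1|apply: s2].
    by rewrite comparable_sym; apply: cQ; [apply: s1|apply: s2].
  - by move=> /setUP[/s1|/s2]; rewrite inE => ->; rewrite ?orbT.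
  move=> Qy cy; rewrite inE; case/setUP: Qy => Qy; apply/orP; [left|right].
    by apply: max1 => // x Ax; apply: cy; rewrite inE Ax.
  by apply: max2 => // x Ax; apply: cy; rewrite inE Ax orbT.
rewrite xpair_eqE; apply/andP; split; apply/eqP/setP => x; rewrite !inE.
  case A1x: (x \in A1); first by rewrite s1.
  by case A2x: (x \in A2) => //=; apply/negP => /dis; apply; apply: s2.
case A2x: (x \in A2); first by rewrite s2 // orbT.
by rewrite orbF; case A1x: (x \in A1) => //=; apply/negP => Q2x; apply: (dis x) => //; apply: s1.
Qed.

Lemma exists_maxchain_in Q : exists A, maxchain_in Q A.
Proof.
have c0 : chain (set0 : {set P}) && (set0 \subset Q).
  by apply/andP; rewrite sub0set; split=> //; apply/chainP => x; rewrite inE.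
by have [A mA _] := @maxset_exists _ (fun A => chain A && (A \subset Q)) _ c0; exists A.
Qed.

Lemma comp_setE v : comp_set v = lt_set v :|: gt_set v.
Proof. by apply/setP => x; rewrite !inE; case: comparableP. Qed.

Lemma covers_elt x y :
  covers (elt x) (elt y) = (x < y)%O && ~~ [exists z, (x < z)%O && (z < y)%O].
Proof.
rewrite /covers /=; congr (_ && ~~ _); apply/existsP/existsP => [[[[]|z]]|[z]] //=.
  by exists z.
by exists (elt z).
Qed.

Lemma covers_elt1 x : covers (elt x) hat1 = (gt_set x == set0).
Proof.
rewrite /covers /=; apply/negP/eqP => [nex|x0].
  apply/setP => z; rewrite !inE; apply/negP => xz; case: nex.
  by apply/existsP; exists (elt z); rewrite /= xz.
case/existsP=> -[[]|z] //=; rewrite ?andbT // => xz.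
by have := in_set0 z; rewrite -x0 inE xz.
Qed.

Lemma covers_0elt x : covers hat0 (elt x) = (lt_set x == set0).
Proof.
rewrite /covers /=; apply/negP/eqP => [nex|x0].
  apply/setP => z; rewrite !inE; apply/negP => xz; case: nex.
  by apply/existsP; exists (elt z); rewrite /= xz.
case/existsP=> -[[]|z] //= xz.
by have := in_set0 z; rewrite -x0 inE xz.
Qed.

(** * Sums over maximal chains and their recursions *)

Context {R : comNzRingType}.
Implicit Types f : P -> R.

Definition chain_sum f Q : R := \sum_(A | maxchain_in Q A) \prod_(y in A) f y.

(** The value 1 at [hat0] and [hat1] stands for the empty chain, so the recursions along covers also
    hold at minimal and maximal elements. *)
Definition hat_chain_sum (Q : P -> {set P}) f (a : hat P) : R :=
  if a is inr y then f y * chain_sum f (Q y) else 1.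

Lemma eq_chain_sum f g Q : {in Q, f =1 g} -> chain_sum f Q = chain_sum g Q.
Proof.
move=> fg; apply: eq_bigr => A /maxchain_inP[_ sA _].
by apply: eq_bigr => y /sA /fg.
Qed.

Lemma chain_sum_mem f Q v : v \in Q ->
  \sum_(A | maxchain_in Q A && (v \in A)) \prod_(y in A) f y =
  f v * chain_sum f (Q :&: comp_set v).
Proof.
move=> Qv; rewrite (reindex_onto (fun B => v |: B) (fun A => A :\ v)) /=; last first.
  by move=> A /andP[_ Av]; rewrite setD1K.
rewrite /chain_sum big_distrr /=; apply: eq_big => [B|B].
  by rewrite -andbA maxchain_in_comp.
rewrite -andbA maxchain_in_comp // => /maxchain_inP[_ sB _].
by rewrite big_setU1 //; apply/negP => /sB; rewrite !inE eqxx andbF.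
Qed.

Lemma chain_sumU f Q1 Q2 :
  [disjoint Q1 & Q2] -> {in Q1 & Q2, forall x y, (x >=< y)%O} ->
  chain_sum f (Q1 :|: Q2) = chain_sum f Q1 * chain_sum f Q2.
Proof.
move=> dQ cQ; rewrite /chain_sum big_distrlr /= pair_big /=.
rewrite (reindex_onto (fun AB : {set P} * {set P} => AB.1 :|: AB.2)
                      (fun A => (A :&: Q1, A :&: Q2))) /=; last first.
  by move=> A /maxchain_inP[_ /subsetP/setIidPl sA _]; rewrite -setIUr sA.
apply: eq_big => [[A1 A2]|[A1 A2]] /=; rewrite maxchain_inU // => /andP[].
move=> /maxchain_inP[_ s1 _] /maxchain_inP[_ s2 _].
rewrite -bigU; first by apply: eq_bigl => x; rewrite !inE.
apply/pred0P => x /=; apply/negP => /andP[/s1 Q1x /s2 Q2x].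
by move/pred0P/(_ x): dQ; rewrite /= Q1x Q2x.
Qed.

(** [S] is an antichain met by each maximal chain of [Q], hence met exactly once; each chain is
    counted under its element of [S]. *)
Lemma chain_sum_split f Q (S : {set P}) : S \subset Q ->
  {in S &, forall x y, (x >=< y)%O -> x = y} ->
  (forall A, maxchain_in Q A -> exists2 x, x \in S & x \in A) ->
  chain_sum f Q = \sum_(y in S) f y * chain_sum f (Q :&: comp_set y).
Proof.
move=> /subsetP SQ Santi Smeet.
under eq_bigr => y Sy do rewrite -chain_sum_mem ?SQ //.
rewrite (exchange_big_dep (maxchain_in Q)) /=; last by move=> y A _ /andP[].
apply: eq_bigr => A mA; have [x Sx Ax] := Smeet A mA.
rewrite [RHS](bigD1 x) ?Sx ?mA ?Ax //= [X in _ + X]big1 ?addr0 // => y /andP[/andP[Sy Ay]].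
case/maxchain_inP: mA => cA _ _; case/eqP; apply: Santi => //; exact: cA.
Qed.

Lemma chain_sum0 f : chain_sum f set0 = 1.
Proof.
rewrite /chain_sum (big_pred1 set0) ?big_set0 // => A.
apply/maxchain_inP/eqP => [[_ sA _]|->].
  by apply/setP => x; rewrite inE; apply/negP => /sA; rewrite inE.
by split=> // x; rewrite inE.
Qed.

Definition strict_order_for_comparable (r : rel P) :=
  [/\ irreflexive r, transitive r & forall x y, (x >=< y)%O = [|| x == y, r x y | r y x]].

(* Stated for an abstract relation in order to apply to both < and >. *)
Lemma chain_sum_above f (r : rel P) x (Q := fun y => [set z | r y z]) :
  strict_order_for_comparable r -> Q x != set0 ->
  chain_sum f (Q x) =
  \sum_(y | r x y && ~~ [exists z, r x z && r z y]) f y * chain_sum f (Q y).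
Proof.
move=> [rirr rtr rcmp] /set0Pn[z xz].
rewrite (@chain_sum_split _ _ [set y | r x y && ~~ [exists z, r x z && r z y]]).
- apply: eq_big => [y|y]; rewrite inE // => /andP[xy nxy].
  congr (_ * chain_sum _ _); apply/setP => t; rewrite !inE rcmp.
  apply/and3P/idP => [[xt ty]|yt].
    rewrite (negPf ty) /=; case/orP => // rty; case/negP: nxy.
    by apply/existsP; exists t; rewrite xt.
  split; [exact: rtr yt | | by rewrite yt !orbT].
  by apply: contraTneq yt => ->; rewrite rirr.
- by apply/subsetP => y; rewrite !inE => /andP[].
- move=> y t; rewrite !inE rcmp => /andP[xy ny] /andP[xt nt].
  case/or3P => [/eqP //|yt|ty].
    by case/negP: nt; apply/existsP; exists y; rewrite xy.
  by case/negP: ny; apply/existsP; exists t; rewrite xt.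
(* A maximal chain is nonempty, as [z] could be added to the empty one. Its first element [m] for
   [r] is found by maximizing [#|Q y|]; it covers [x], since any [c] strictly between could be
   added. *)
move=> A /maxchain_inP[cA sA maxA].
have [a Aa] : exists a, a \in A.
  apply/set0Pn; apply/eqP => A0.
  have : z \in A by apply: maxA xz _ => y; rewrite A0 inE.
  by rewrite A0 inE.
have [m Am mmax] := @arg_maxnP _ a (mem A) (fun y => #|Q y|) Aa.
have mlt y : y \in A -> y != m -> r m y.
  move=> Ay ynm; have := cA _ _ Am Ay; rewrite rcmp eq_sym (negPf ynm) /=.
  case/orP => // ym; have : (#|Q m| < #|Q y|)%N.
    apply: proper_card; apply/properP; split.
      by apply/subsetP => t; rewrite !inE => ty; apply: rtr ty.
    by exists m; rewrite !inE ?rirr.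
  by rewrite ltnNge; move/negP; case; exact: mmax.
exists m => //; rewrite inE; have := sA _ Am; rewrite inE => -> /=.
apply/negP => /existsP[c /andP[xc cm]].
have cr y : y \in A -> r c y.
  by move=> Ay; case: (eqVneq y m) => [->//|/(mlt _ Ay)]; apply: rtr.
have Ac : c \in A.
  by apply: maxA => [|y Ay]; rewrite ?inE // rcmp (cr y) // !orbT.
by have := cr _ Ac; rewrite rirr.
Qed.

Lemma strict_order_lt : strict_order_for_comparable (fun x y => (x < y)%O).
Proof.
by split=> [x|y x z|x y]; [exact: ltxx|exact: lt_trans|case: comparableP].
Qed.

Lemma strict_order_gt : strict_order_for_comparable (fun x y => (y < x)%O).
Proof.
split=> [x|y x z xy yz|x y]; [exact: ltxx|exact: lt_trans yz xy|].
by case: comparableP.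
Qed.

Lemma chain_sum_gt f x :
  chain_sum f (gt_set x) =
  \sum_(a | covers (elt x) a) hat_chain_sum gt_set f a.
Proof.
rewrite big_sumType /= big_mkcond big_bool /= covers_elt1 addr0.
case: (eqVneq (gt_set x) set0) => [x0|x0]; last first.
  rewrite add0r (chain_sum_above _ _ _ strict_order_lt) //.
  by apply: eq_bigl => y; rewrite covers_elt.
rewrite {1}x0 chain_sum0 big_pred0 ?addr0 // => y; rewrite covers_elt.
by have := in_set0 y; rewrite -x0 inE => ->.
Qed.

Lemma chain_sum_lt f x :
  chain_sum f (lt_set x) =
  \sum_(a | covers a (elt x)) hat_chain_sum lt_set f a.
Proof.
rewrite big_sumType /= big_mkcond big_bool /= covers_0elt add0r.
case: (eqVneq (lt_set x) set0) => [x0|x0]; last first.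
  rewrite add0r (chain_sum_above _ _ _ strict_order_gt) //.
  apply: eq_bigl => y; rewrite covers_elt; congr (_ && ~~ _).
  by apply: eq_existsb => z; rewrite andbC.
rewrite {1}x0 chain_sum0 big_pred0 ?addr0 // => y; rewrite covers_elt.
by have := in_set0 y; rewrite -x0 inE => ->.
Qed.

(** Every element below [v] is comparable to every element above it, so the rest of the chain splits
    into independent halves. *)
Lemma chain_sum_through f v :
  \sum_(A : {set P} | maxset chain A && (v \in A)) \prod_(y in A) f y =
  f v * (chain_sum f (lt_set v) * chain_sum f (gt_set v)).
Proof.
under eq_bigl do rewrite -maxchain_inT.
rewrite chain_sum_mem ?inE // setTI comp_setE chain_sumU //.
  by apply/pred0P => x /=; rewrite !inE; case: comparableP.
move=> x y; rewrite !inE => xv vy; exact: lt_comparable (lt_trans xv vy).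
Qed.

(** Induction on the bound, removing the head. Passing to a cover shrinks the set of elements above,
    so the bound truncates no chain. *)
Lemma chain_sum_bseq f n x : (#|[set y | x <= y]%O| <= n)%N ->
  \sum_(s : n.-bseq P | (ohead s == Some x) &&
      sorted covers (rcons (map elt s) hat1)) \prod_(y <- s) f y =
  f x * chain_sum f (gt_set x).
Proof.
elim: n x => [|n IHn] x xn.
  suff: (0 < #|[set y | x <= y]%O|)%N by rewrite ltnNge xn.
  by apply/card_gt0P; exists x; rewrite inE.
pose h (t : n.-bseq P) : n.+1.-bseq P := [bseq of x :: t].
pose h' (s : n.+1.-bseq P) : n.-bseq P := [bseq of behead s].
rewrite (reindex_onto h h'); last first.
  by case=> -[//|y s] ys /andP[/eqP[yx] _]; apply/val_inj; rewrite /= -yx.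
have hK t : h' (h t) == t by apply/eqP/val_inj.
under eq_bigl do rewrite hK andbT /= eqxx /=.
under eq_bigr do rewrite big_cons.
rewrite -big_distrr /= chain_sum_gt; congr (_ * _).
(* With an empty tail the next element is [hat1]. Nonempty tails are grouped by [head x t], which
   never returns its default there. *)
rewrite (bigID (fun t : n.-bseq P => t == [bseq])) /=.
rewrite big_sumType /= big_mkcond /= [in RHS]big_mkcond big_bool /= addr0.
congr (_ + _).
  rewrite -big_mkcond /= (eq_bigl (fun t => (t == [bseq]) && covers (elt x) hat1)).
    case: ifP => _; last by rewrite big_pred0 // => t; rewrite andbF.
    by rewrite (big_pred1 [bseq]) ?big_nil // => t; rewrite andbT.
  by move=> t; rewrite andbC; case: eqP => // -> /=; rewrite andbT.
rewrite (partition_big (fun t : n.-bseq P => head x t) (fun y => covers (elt x) (elt y))) /=.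
  apply: eq_bigr => y xy; rewrite -IHn; last first.
    rewrite -ltnS (leq_trans _ xn) //; apply: proper_card; apply/properP.
    move: xy; rewrite covers_elt => /andP[xy _]; split.
      by apply/subsetP => z; rewrite !inE; apply/le_trans/ltW.
    by exists x; rewrite !inE // lt_geF.
  apply: eq_bigl => -[[|z t] zt]; rewrite -val_eqE //=; first by rewrite andbF.
  rewrite andbT andbC -[Some _ == _]/(z == y); case: eqVneq => //= ->.
  by rewrite xy.
by case=> -[|z t] zt; rewrite -val_eqE //= ?andbF // andbT => /andP[].
Qed.

End ChainSum.

(** * Listings compatible with the order *)

Section Listings.
Context {d : Order.disp_t} {P : finPOrderType d}.
Implicit Types (x y v : P) (s t : seq P).

(** Every prefix is a down-set; splitting the list fits toggles applied one entry at a time. *)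
Definition down_listing t :=
  uniq t /\ forall t1 x t2, t = t1 ++ x :: t2 -> forall y, (y < x)%O -> y \in t1.

Lemma down_listing_rcons t x : down_listing (rcons t x) -> down_listing t.
Proof.
rewrite /down_listing rcons_uniq => -[/andP[_ ut] tP]; split=> // t1 y t2 tE.
by apply: (tP t1 y (rcons t2 x)); rewrite tE rcons_cat.
Qed.

(** If [t1] contained some [y > x], then [x] would precede it and so occur twice. Thus an upward
    pass toggles nothing above [x] before [x]. *)
Lemma down_listing_notin t1 x t2 y :
  down_listing (t1 ++ x :: t2) -> (x <= y)%O -> y \notin t1.
Proof.
move=> [ut tP]; rewrite le_eqVlt => xy.
have xt1 : x \notin t1 by move: ut; rewrite cat_uniq /= negb_or => /and3P[_ /andP[]].
case/orP: xy => [/eqP <- //|xy].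
apply/negP => /splitPr yt; case: yt tP xt1 => p1 p2 tP; case/negP.
by rewrite mem_cat (tP p1 y (p2 ++ x :: t2)) // -catA.
Qed.

Lemma linear_extension_down v s :
  linear_extension [pred x : P | (x < v)%O] s -> down_listing (rcons s v).
Proof.
move=> [us sE sP]; split.
  by rewrite rcons_uniq us sE /= inE ltxx.
move=> t1 x t2; case/lastP: t2 => [|t2 z].
  rewrite cats1 => /rcons_inj[<- <-] y yv; by rewrite sE.
rewrite -rcons_cons -rcons_cat => /rcons_inj[tE _] y yx.
have xs : x \in s by rewrite tE mem_cat mem_head orbT.
have ys : y \in s by move: xs; rewrite !sE !inE; apply: lt_trans.
(* If [y] were missing from [t1], its index in [s] would be at least that of [x]. *)
have := sP _ _ ys xs yx; apply: contraTT => yt1.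
have xt1 : x \notin t1 by move: us; rewrite tE cat_uniq /= negb_or => /and3P[_ /andP[]].
by rewrite tE !index_cat (negPf yt1) (negPf xt1) /= eqxx addn0 -leqNgt leq_addr.
Qed.

End Listings.

(** * Effect of the toggles in terms of chain sums *)

Section Toggles.
Context {K : fieldType} {d : Order.disp_t} {P : finPOrderType d}.
Implicit Types (C : K) (f g : {ffun P -> K}) (x y v : P) (s t : seq P).

Definition up_sum f x : K := f x * chain_sum f (gt_set x).
Definition down_sum f x : K := f x * chain_sum f (lt_set x).

Lemma Delta_invE f : Delta_inv f = Some [ffun x => up_sum f x].
Proof.
congr Some; apply/ffunP => x; rewrite !ffunE.
by apply: chain_sum_bseq; rewrite max_card.
Qed.

Definition Theta_Delta_inv C f : {ffun P -> K} := [ffun x => C / up_sum f x].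

Lemma Theta_Delta_invE C f :
  (Theta C \po Delta_inv) f =
  if [forall x, up_sum f x != 0] then Some (Theta_Delta_inv C f) else None.
Proof.
rewrite /pcomp Delta_invE /= /Theta.
under eq_forallb do rewrite ffunE.
case: ifP => // _; congr Some; apply/ffunP => x; by rewrite !ffunE.
Qed.

(** By the cover recursions, the lower labels add up to a chain sum of [f], and the reciprocals of
    the upper ones to a chain sum of [f'] over [C]. Two labelings occur because on the way down the
    labels above already come from the toggled one. *)
Lemma order_toggle_chain_sum C x f f' g : C != 0 ->
  (forall y, (y < x)%O -> g y = down_sum f y) ->
  (forall y, (x < y)%O -> g y = C / up_sum f' y) ->
  (forall y, (x < y)%O -> up_sum f' y != 0) ->
  chain_sum f' (gt_set x) != 0 ->
  order_toggle C x g =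
    if g x != 0
    then Some (relabel x (chain_sum f (lt_set x) * C /
                          (g x * chain_sum f' (gt_set x))) g)
    else None.
Proof.
move=> C0 glo gup up0 cs0; rewrite /order_toggle.
have -> : \sum_(a | covers a (elt x)) hat_label C g a = chain_sum f (lt_set x).
  rewrite chain_sum_lt; apply: eq_bigr => -[[]|y] //= /andP[/= yx _].
  exact: glo.
have gupE (a : hat P) : covers (elt x) a ->
    (hat_label C g a)^-1 = C^-1 * hat_chain_sum gt_set f' a.
  case: a => [[]|y] //= => [_|/andP[/= xy _]]; first by rewrite mulr1.
  by rewrite gup // invf_div mulrC.
have -> : \sum_(a | covers (elt x) a) (hat_label C g a)^-1 =
          C^-1 * chain_sum f' (gt_set x).
  by rewrite chain_sum_gt big_distrr /=; apply: eq_bigr => a /gupE.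
have -> : [forall (a : hat P | covers (elt x) a), hat_label C g a != 0].
  apply/forall_inP => -[[]|y] //= /andP[/= xy _].
  by rewrite gup // mulf_neq0 ?invr_eq0 ?up0.
rewrite mulf_neq0 ?invr_eq0 // /= andbT; case: ifP => // g0.
by congr Some; congr relabel; field; rewrite g0 C0 cs0.
Qed.

(** In [rev t] the first entry of [t] acts first, so at the turn of [x] the elements below carry
    [down_sum] and those above their original labels. *)
Lemma toggles_up C f t : C != 0 -> (forall x, up_sum f x != 0) ->
  down_listing t ->
  toggles C (rev t) (Theta_Delta_inv C f) =
    Some [ffun y => if y \in t then down_sum f y else C / up_sum f y].
Proof.
move=> C0 up0; elim/last_ind: t => [_|t x IHt tP].
  by congr Some; apply/ffunP => y; rewrite !ffunE.
rewrite rev_rcons /= /pcomp IHt /=; last exact: down_listing_rcons tP.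
have {}tP : down_listing (t ++ x :: [::]) by rewrite cats1.
have tN y : (x <= y)%O -> y \notin t by apply: down_listing_notin tP.
have cs0 : chain_sum f (gt_set x) != 0 by have := up0 x; rewrite mulf_eq0 negb_or => /andP[].
have f0 : f x != 0 by have := up0 x; rewrite mulf_eq0 negb_or => /andP[].
rewrite (@order_toggle_chain_sum _ _ f f) //; first last.
- by move=> y xy; rewrite ffunE (negPf (tN y (ltW xy))).
- by move=> y yx; rewrite ffunE (tP.2 t x [::]).
rewrite ffunE (negPf (tN x _)) // mulf_neq0 ?invr_eq0 //.
congr Some; apply/ffunP => y; rewrite !ffunE mem_rcons inE; case: eqVneq => //= ->.
by rewrite /up_sum /down_sum; field; rewrite cs0 f0 C0.
Qed.

(** The entries of [t2] are toggled back from last to first. The toggle at [x] needs the label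
    [down_sum f x] to be nonzero, whence the condition on [chain_sum]. *)
Lemma toggles_down C f f' t1 t2 : C != 0 -> (forall x, f x != 0) ->
  (forall x, up_sum f' x != 0) -> down_listing (t1 ++ t2) ->
  {in t2, f' =1 f} ->
  toggles C t2 [ffun y => if y \in t1 ++ t2 then down_sum f y else C / up_sum f' y] =
    if all (fun x => chain_sum f (lt_set x) != 0) t2
    then Some [ffun y => if y \in t1 then down_sum f y else C / up_sum f' y]
    else None.
Proof.
move=> C0 f0 up0; elim: t2 t1 => [t1 _ _|x t2 IHt t1 tP ff'] /=.
  by rewrite cats0.
rewrite /pcomp -cat_rcons IHt ?cat_rcons //; last first.
  by move=> y yt; apply: ff'; rewrite inE yt orbT.
rewrite andbC; case: ifP => //= _.
have tN y : (x <= y)%O -> y \notin t1 by apply: down_listing_notin tP.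
have cs0 : chain_sum f' (gt_set x) != 0 by have := up0 x; rewrite mulf_eq0 negb_or => /andP[].
rewrite (@order_toggle_chain_sum _ _ f f') //; first last.
- by move=> y xy; rewrite ffunE mem_rcons inE gt_eqF // (negPf (tN y (ltW xy))).
- by move=> y yx; rewrite ffunE mem_rcons inE (tP.2 t1 x t2) ?orbT.
rewrite ffunE mem_rcons mem_head {1}/down_sum mulf_eq0 (negPf (f0 x)) /=.
case: ifP => // l0.
congr Some; apply/ffunP => y; rewrite !ffunE mem_rcons inE; case: eqVneq => //= ->.
rewrite (negPf (tN x _)) // /up_sum /down_sum ff' ?mem_head //.
by field; rewrite l0 cs0 f0.
Qed.

(** Serves the case [C = 0], where [Theta] yields the zero labeling, at which every toggle is
    undefined. *)
Lemma toggles_zero C t g : toggles C t [ffun=> 0] = Some g -> g = [ffun=> 0].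
Proof.
elim: t g => [|x t IHt] g /=; first by case.
rewrite /pcomp; case: (toggles C t _) IHt => //= g' /(_ _ erefl) ->.
by rewrite /order_toggle ffunE eqxx.
Qed.

Lemma tau_star_zero C s v : tau_star C s v [ffun=> 0] = None.
Proof.
rewrite /tau_star /pcomp; case E: (toggles C (rev s) _) => [g|] //=.
by rewrite (toggles_zero _ _ _ E) /order_toggle ffunE eqxx.
Qed.

Definition toggled C v f : {ffun P -> K} :=
  relabel v (C / (f v * (chain_sum f (lt_set v) * chain_sum f (gt_set v)))) f.

Lemma antichain_toggleE C v f :
  antichain_toggle C v f =
  if f v * (chain_sum f (lt_set v) * chain_sum f (gt_set v)) != 0
  then Some (toggled C v f) else None.
Proof. by rewrite /antichain_toggle chain_sum_through. Qed.

(** The toggle at [v] ends the upward pass along [rcons s v]; the labeling reached is also the start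
    of the downward pass for [toggled C v f]. *)
Lemma tau_starE C f v s : C != 0 -> (forall x, up_sum f x != 0) ->
  f v * (chain_sum f (lt_set v) * chain_sum f (gt_set v)) != 0 ->
  (forall x, up_sum (toggled C v f) x != 0) ->
  linear_extension [pred x : P | (x < v)%O] s ->
  tau_star C s v (Theta_Delta_inv C f) =
    if all (fun x => chain_sum f (lt_set x) != 0) s
    then Some (Theta_Delta_inv C (toggled C v f)) else None.
Proof.
move=> C0 up0 tot0 up0' s_lin; set f' := toggled C v f.
have svP := linear_extension_down _ _ s_lin.
have f0 x : f x != 0 by have := up0 x; rewrite mulf_eq0 negb_or => /andP[].
have csE x : ~~ (x < v)%O -> chain_sum f' (gt_set x) = chain_sum f (gt_set x).
  move=> xv; apply: eq_chain_sum => y; rewrite inE => xy; rewrite ffunE ifN //.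
  by apply: contraNneq xv => <-.
have [us sE _] := s_lin.
have -> : tau_star C s v (Theta_Delta_inv C f) =
    obind (toggles C s) (toggles C (rev (rcons s v)) (Theta_Delta_inv C f)).
  by rewrite rev_rcons /tau_star /= /pcomp; case: (toggles C (rev s) _).
rewrite toggles_up //=.
have -> : [ffun y => if y \in rcons s v then down_sum f y else C / up_sum f y] =
    [ffun y => if y \in [::] ++ s then down_sum f y else C / up_sum f' y] :> {ffun P -> K}.
  apply/ffunP => y; rewrite !ffunE mem_rcons inE /= sE inE.
  (* At [v], the product of the old label, the new label and the two chain sums is [C]. At other
     elements not below [v], the upper chain sum does not involve [v]. *)
  case: eqVneq => [->|yv] /=.
    rewrite ltxx /up_sum csE ?ltxx // ffunE eqxx /down_sum.
    move: tot0; rewrite !mulf_eq0 !negb_or => /and3P[fv0 lv0 uv0].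
    by field; rewrite C0 fv0 lv0 uv0.
  by case: ifP => // /negbT yv'; rewrite /up_sum csE // ffunE (negPf yv).
rewrite toggles_down //.
- exact: down_listing_rcons svP.
- by move=> y; rewrite sE inE => yv; rewrite ffunE lt_eqF.
Qed.

End Toggles.

(** * Dependence on one label, and nonvanishing at ones *)

Section Generic.
Context {d : Order.disp_t} {P : finPOrderType d}.
Implicit Types (v : P) (Q : {set P}).

Lemma rmorph_chain_sum (R S : comNzRingType) (phi : {rmorphism R -> S}) (f : P -> R) Q :
  phi (chain_sum f Q) = chain_sum (phi \o f) Q.
Proof. by rewrite rmorph_sum; apply: eq_bigr => A _; rewrite rmorph_prod. Qed.

Definition subst_at {R : comNzRingType} v (c : R) (f : P -> R) : P -> R :=
  fun x => if x == v then c else f x.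

(** A chain contains [v] at most once, so its product is either free of the label at [v] or linear
    in it. *)
Lemma chain_sum_affine (R : comNzRingType) v (c : R) (f : P -> R) Q :
  chain_sum (subst_at v c f) Q = chain_sum (subst_at v 0 f) Q +
    c * (chain_sum (subst_at v 1 f) Q - chain_sum (subst_at v 0 f) Q).
Proof.
rewrite -sumrB big_distrr -big_split; apply: eq_bigr => A _ /=.
have [vA|vA] := boolP (v \in A); last first.
  have prodE b : \prod_(y in A) subst_at v b f y = \prod_(y in A) f y.
    by apply: eq_bigr => y yA; rewrite /subst_at ifN //; apply: contraNneq vA => <-.
  by rewrite !prodE subrr mulr0 addr0.
have prodE b : \prod_(y in A) subst_at v b f y = b * \prod_(y in A | y != v) f y.
  rewrite (bigD1 v) //= {1}/subst_at eqxx; congr (_ * _).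
  by apply: eq_bigr => y /andP[_ yv]; rewrite /subst_at (negPf yv).
by rewrite !prodE mul0r subr0 mul1r add0r.
Qed.

(** The sum counts the maximal chains of [Q], of which at least one exists; characteristic zero
    keeps the count nonzero. *)
Lemma chain_sum1_neq0 (K : fieldType) Q :
  [pchar K] =i pred0 -> chain_sum (fun=> 1 : K) Q != 0.
Proof.
move=> /pcharf0P K0; rewrite /chain_sum.
under eq_bigr do rewrite big1_eq.
rewrite sumr_const K0 -lt0n; apply/card_gt0P.
exact: exists_maxchain_in.
Qed.

End Generic.

(** * Polynomials controlling the domains *)

Section GenericDomain.
Context {K : fieldType} {d : Order.disp_t} {P : finPOrderType d}.
Context (K_char0 : [pchar K] =i pred0) (v : P).
Implicit Types (C : K) (f : {ffun P -> K}).

(* The product of [chain_sum] of the toggled labeling with the denominator of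
   the toggle, which is polynomial in the labels and in [c]. *)
Definition cleared_sum {R : comNzRingType} (c : R) (F : P -> R) (x : P) : R :=
  let den := F v * (chain_sum F (lt_set v) * chain_sum F (gt_set v)) in
  let sum0 := chain_sum (subst_at v 0 F) (gt_set x) in
  let sum1 := chain_sum (subst_at v 1 F) (gt_set x) in
  den * sum0 + c * (sum1 - sum0).

(** Applied to evaluation of univariate and of multivariate polynomials. *)
Lemma rmorph_cleared_sum (R S : comNzRingType) (phi : {rmorphism R -> S})
    (c : R) (F : P -> R) x :
  phi (cleared_sum c F x) = cleared_sum (phi c) (phi \o F) x.
Proof.
rewrite /cleared_sum !(rmorphD, rmorphM, rmorphN) /= !rmorph_chain_sum.
have substE b : chain_sum (phi \o subst_at v b F) (gt_set x) =
    chain_sum (subst_at v (phi b) (phi \o F)) (gt_set x).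
  by apply: eq_chain_sum => y _; rewrite /subst_at /=; case: ifP.
by rewrite !substE rmorph0 rmorph1.
Qed.

Lemma eq_cleared_sum (R : comNzRingType) (c : R) (F G : P -> R) x :
  F =1 G -> cleared_sum c F x = cleared_sum c G x.
Proof.
move=> FG; have csE Q : chain_sum F Q = chain_sum G Q by apply: eq_chain_sum.
have substE b Q : chain_sum (subst_at v b F) Q = chain_sum (subst_at v b G) Q.
  by apply: eq_chain_sum => y _; rewrite /subst_at FG.
by rewrite /cleared_sum FG !csE !substE.
Qed.

(** The affine formula at the new label [C / den], multiplied through by [den]. *)
Lemma cleared_sumE C f x (den := f v * (chain_sum f (lt_set v) * chain_sum f (gt_set v))) :
  den != 0 -> cleared_sum C f x = den * chain_sum (toggled C v f) (gt_set x).
Proof.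
move=> den0; have -> : chain_sum (toggled C v f) (gt_set x) =
    chain_sum (subst_at v (C / den) f) (gt_set x).
  by apply: eq_chain_sum => y _; rewrite ffunE.
rewrite chain_sum_affine /cleared_sum /= -/den [RHS]mulrDr; congr (_ + _).
by rewrite mulrA (mulrC den) divfK.
Qed.

(** All labels are set to 1 and the constant is the indeterminate; the factor ['X] excludes
    [C = 0]. *)
Definition generic_const_poly : {poly K} :=
  'X * \prod_x cleared_sum 'X (fun=> 1) x.

Lemma generic_const_polyE C :
  generic_const_poly.[C] = C * \prod_x cleared_sum C (fun=> 1) x.
Proof.
rewrite hornerM hornerX horner_prod; congr (_ * _); apply: eq_bigr => x _.
have := rmorph_cleared_sum _ _ (horner_eval C) 'X (fun=> 1) x.
rewrite /= !horner_evalE hornerX => ->.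
by apply: eq_cleared_sum => y /=; rewrite /horner_eval hornerC.
Qed.

(* The witness is [C] = the number of maximal chains through [v]: the toggle then
   fixes the labeling by ones, so no [chain_sum] of the result vanishes. *)
Lemma generic_const_poly_neq0 : generic_const_poly != 0.
Proof.
pose f : {ffun P -> K} := [ffun=> 1].
have cs0 Q : chain_sum f Q != 0.
  have -> : chain_sum f Q = chain_sum (fun=> 1) Q.
    by apply: eq_chain_sum => y _; rewrite ffunE.
  exact: chain_sum1_neq0.
pose den := f v * (chain_sum f (lt_set v) * chain_sum f (gt_set v)).
have den0 : den != 0 by rewrite !mulf_neq0 ?cs0 // ffunE oner_eq0.
have : generic_const_poly.[den] != 0.
  rewrite generic_const_polyE mulf_neq0 //; apply/prodf_neq0 => x _.
  have -> : cleared_sum den (fun=> 1) x = cleared_sum den f x.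
    by apply: eq_cleared_sum => y; rewrite ffunE.
  rewrite cleared_sumE // mulf_neq0 //.
  have -> : toggled den v f = f; last exact: cs0.
  by apply/ffunP => y; rewrite ffunE divff // [RHS]ffunE; case: ifP => // _; rewrite ffunE.
by apply: contra_neq => ->; rewrite horner0.
Qed.

(** [F] is the labeling by indeterminates. The factors at [x] control its label, both chain sums,
    and the upper chain sum after the toggle. *)
Definition generic_label_poly C : {mpoly K[#|P|]} :=
  let F x := 'X_(enum_rank x) in
  \prod_x (F x * (chain_sum F (lt_set x) * chain_sum F (gt_set x))
           * cleared_sum C%:MP F x).

Lemma generic_label_polyE C f :
  (generic_label_poly C).@[fun i => f (enum_val i)] =
  \prod_x (f x * (chain_sum f (lt_set x) * chain_sum f (gt_set x))
           * cleared_sum C f x).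
Proof.
rewrite rmorph_prod; apply: eq_bigr => x _.
rewrite !rmorphM /= !rmorph_chain_sum rmorph_cleared_sum /= mevalC mevalXU enum_rankK.
have FE : meval (fun i => f (enum_val i)) \o (fun x => 'X_(enum_rank x)) =1 f.
  by move=> y; rewrite /= mevalXU enum_rankK.
by rewrite (eq_cleared_sum _ _ _ _ _ FE); do 2!congr (_ * _); congr (_ * _);
  apply: eq_chain_sum => y _; rewrite FE.
Qed.

(** At the labeling by ones, the cleared sums are factors of [generic_const_poly.[C]] and the other
    sums count chains. *)
Lemma generic_label_poly_neq0 C : generic_const_poly.[C] != 0 -> generic_label_poly C != 0.
Proof.
rewrite generic_const_polyE mulf_eq0 negb_or => /andP[_ /prodf_neq0 cl0].
pose f : {ffun P -> K} := [ffun=> 1].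
have fE : f =1 (fun=> 1) by move=> y; rewrite ffunE.
have : (generic_label_poly C).@[fun i => f (enum_val i)] != 0.
  rewrite generic_label_polyE; apply/prodf_neq0 => x _.
  rewrite fE (eq_cleared_sum _ _ _ _ _ fE) !mulf_neq0 ?oner_eq0 ?cl0 //.
    by rewrite (eq_chain_sum f (fun=> 1)) ?chain_sum1_neq0 // => y _; apply: fE.
  by rewrite (eq_chain_sum f (fun=> 1)) ?chain_sum1_neq0 // => y _; apply: fE.
by apply: contra_neq => ->; rewrite meval0.
Qed.

End GenericDomain.

(** * Agreement of the two maps and their generic domain *)

Theorem theorem3p12 (K : fieldType) (K_char0 : [pchar K] =i pred0)
    (d : Order.disp_t) (P : finPOrderType d) (v : P) (s : seq P)
    (s_linext : linear_extension [pred x : P | (x < v)%O] s) :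
  (forall (C : K) (f g h : {ffun P -> K}),
      (Theta C \po Delta_inv \po antichain_toggle C v) f = Some g ->
      (tau_star C s v \po Theta C \po Delta_inv) f = Some h ->
      g = h)
  /\ generic_constant (fun C : K => generic_labeling (fun f : {ffun P -> K} =>
       ((Theta C \po Delta_inv \po antichain_toggle C v) f : bool) /\
       ((tau_star C s v \po Theta C \po Delta_inv) f : bool))).
Proof.
pose den (f : {ffun P -> K}) := f v * (chain_sum f (lt_set v) * chain_sum f (gt_set v)).
have lhsE C f : (Theta C \po Delta_inv \po antichain_toggle C v) f =
    if (den f != 0) && [forall x, up_sum (toggled C v f) x != 0]
    then Some (Theta_Delta_inv C (toggled C v f)) else None.
  rewrite {1}/pcomp antichain_toggleE -/(den f); case: (den f != 0) => //=.
  exact: Theta_Delta_invE.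
have rhsE C f : (tau_star C s v \po Theta C \po Delta_inv) f =
    if [forall x, up_sum f x != 0] then tau_star C s v (Theta_Delta_inv C f) else None.
  have := Theta_Delta_invE C f; rewrite /pcomp Delta_invE /= => ->.
  by case: ifP.
split=> [C f g h|].
  rewrite lhsE rhsE; case: ifP => // /andP[den0 /forallP up0'] [<-].
  case: ifP => // /forallP up0.
  (* For [C = 0] the right side is undefined, since [tau_star] would act on the zero labeling. *)
  have [->|C0] := eqVneq C 0.
    rewrite (_ : Theta_Delta_inv 0 f = [ffun=> 0]) ?tau_star_zero //.
    by apply/ffunP => x; rewrite !ffunE mul0r.
  by rewrite tau_starE //; case: ifP => // _ [].
exists (generic_const_poly v); first exact: generic_const_poly_neq0.
move=> C qC; exists (generic_label_poly v C); first exact: generic_label_poly_neq0.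
move=> f; rewrite generic_label_polyE => /prodf_neq0 pf.
have C0 : C != 0.
  by move: qC; rewrite generic_const_polyE mulf_eq0 negb_or => /andP[].
have lab0 x : [/\ f x != 0, chain_sum f (lt_set x) != 0 & chain_sum f (gt_set x) != 0].
  by have := pf x isT; rewrite !mulf_eq0 !negb_or => /andP[/and3P[]].
have den0 : den f != 0 by have [? ? ?] := lab0 v; rewrite !mulf_neq0.
have up0 x : up_sum f x != 0 by have [? ? ?] := lab0 x; rewrite mulf_neq0.
(* The new label at [v] is [C / den f]; the upper chain sum is a factor of the cleared one. *)
have up0' x : up_sum (toggled C v f) x != 0.
  have [f0 _ _] := lab0 x; rewrite mulf_neq0 //.
    by rewrite ffunE; case: ifP => // _; rewrite mulf_neq0 ?invr_eq0.
  have := pf x isT; rewrite mulf_eq0 negb_or => /andP[_].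
  by rewrite cleared_sumE // mulf_eq0 negb_or => /andP[].
rewrite lhsE rhsE den0 !(introT forallP) //= tau_starE //.
by rewrite (introT allP) // => x _; have [] := lab0 x.
Qed.
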